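(* Let $X$ be a Banach space. Assume that either (i) $X$ coarsely embeds into an upper stable metric space, or (ii) the unit ball of $X$ uniformly embeds into an upper stable metric space. Then every spreading basic sequence in $X$ is unconditional.
   Context: For a set $M\subseteq\mathbb{N}$ and $k\ge 0$, $[M]^k$ is the set of $k$-element subsets of $M$, written as increasing tuples $\bar n=(n_1,\dots,n_k)$, $n_1<\dots<n_k$; $[k]=\{1,\dots,k\}$. Upper stability: a metric space $(Y,d_Y)$ is $K_u$-upper stable ($K_u>0$) if for every $k\ge1$, every $1\le\ell\le k$, every permutation $\pi\colon[k]\to[k]$ which preserves the order on $\{1,\dots,\ell\}$ and on $\{\ell+1,\dots,k\}$, all bounded maps $f\colon[\mathbb{N}]^\ell\to Y$ and $g\colon[\mathbb{N}]^{k-\ell}\to Y$, and every infinite $M\subseteq\mathbb{N}$, $$\inf_{\bar n\in[M]^k}d_Y\big(f(n_1,\dots,n_\ell),g(n_{\ell+1},\dots,n_k)\big)\le K_u\sup_{\bar n\in[M]^k}d_Y\big(f(n_{\pi(1)},\dots,n_{\pi(\ell)}),g(n_{\pi(\ell+1)},\dots,n_{\pi(k)})\big).$$ It is upper stable if it is $K_u$-upper stable for some $K_u>0$. Embeddings: for a map $\varphi\colon(A,d_A)\to(Y,d_Y)$ between metric spaces let $\rho_\varphi(t)=\inf\{d_Y(\varphi(x),\varphi(y)): d_A(x,y)\ge t\}$ and $\omega_\varphi(t)=\sup\{d_Y(\varphi(x),\varphi(y)): d_A(x,y)\le t\}$. The map $\varphi$ is a coarse embedding if $\lim_{t\to\infty}\rho_\varphi(t)=\infty$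 and $\omega_\varphi(t)<\infty$ for all $t>0$; it is a uniform embedding if $\lim_{t\to0}\omega_\varphi(t)=0$ and $\rho_\varphi(t)>0$ for all $t>0$. Sequences: a basic sequence $\{x_n\}_{n=1}^\infty$ in $X$ is spreading if there exist $A_s,B_s\ge1$ such that for all $k\ge1$, $a_1,\dots,a_k\in\mathbb{R}$ and $1\le m_1<\dots<m_k$ in $\mathbb{N}$, $\frac1{B_s}\|\sum_{i=1}^ka_ix_i\|\le\|\sum_{i=1}^ka_ix_{m_i}\|\le A_s\|\sum_{i=1}^ka_ix_i\|$. It is unconditional if there exists $C_u\ge1$ such that for all $k\ge1$, $a_1,\dots,a_k\in\mathbb{R}$ and $\varepsilon_1,\dots,\varepsilon_k\in\{-1,1\}$, $\frac1{C_u}\|\sum_{n=1}^ka_nx_n\|\le\|\sum_{n=1}^k\varepsilon_na_nx_n\|\le C_u\|\sum_{n=1}^ka_nx_n\|$. *)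

(* Defs.v *)
From HB Require Import structures.
From mathcomp Require Import all_boot all_order all_algebra all_fingroup.
From mathcomp Require Import all_classical all_reals all_analysis.

Set Implicit Arguments.
Unset Strict Implicit.
Unset Printing Implicit Defensive.

Import Order.TTheory GRing.Theory Num.Theory.
Import numFieldNormedType.Exports.

Local Open Scope classical_set_scope.
Local Open Scope ring_scope.

(* $[M]^k$: the k-element subsets of M, as strictly increasing k-tuples. *)
Definition incr_tuples (M : set nat) (k : nat) : set (k.-tuple nat) :=
  [set n : k.-tuple nat | sorted ltn n /\ forall i, M (tnth n i)].
Arguments incr_tuples M k : clear implicits.

Definition subtuple (k l : nat) (n : k.-tuple nat) (h : 'I_l -> 'I_k) :
    l.-tuple nat :=
  [tuple tnth n (h i) | i < l].

(* A map $[\mathbb N]^l \to Y$ is represented by a map on all l-tuples, of which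
   only the values at strictly increasing tuples are ever used. *)
Definition bounded_incr_map (R : realType) (Y : metricType R) (l : nat)
    (f : l.-tuple nat -> Y) : Prop :=
  exists C : R, forall s t : l.-tuple nat,
    incr_tuples setT l s -> incr_tuples setT l t -> mdist (f s) (f t) <= C.

(* Here $k = l + m$: the indices $1, \dots, l$ are the [lshift m i], i < l, and
   $l+1, \dots, k$ are the [rshift l j], j < m. *)
Definition order_preserving_on_blocks (l m : nat) (pi : 'S_(l + m)) : Prop :=
  (forall i j : 'I_l, (i < j)%N -> (pi (lshift m i) < pi (lshift m j))%N) /\
  (forall i j : 'I_m, (i < j)%N -> (pi (rshift l i) < pi (rshift l j))%N).

Definition K_upper_stable (R : realType) (Y : metricType R) (Ku : R) : Prop :=
  forall (l m : nat) (pi : 'S_(l + m)),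
    (1 <= l)%N ->
    order_preserving_on_blocks pi ->
    forall (f : l.-tuple nat -> Y) (g : m.-tuple nat -> Y),
      bounded_incr_map f -> bounded_incr_map g ->
      forall M : set nat, infinite_set M ->
        (ereal_inf [set (mdist (f (subtuple n (lshift m)))
                               (g (subtuple n (@rshift l m))))%:E
                     | n in incr_tuples M (l + m)%N]
         <= Ku%:E *
            ereal_sup [set (mdist (f (subtuple n (fun i => pi (lshift m i))))
                                  (g (subtuple n (fun j => pi (rshift l j)))))%:E
                        | n in incr_tuples M (l + m)%N])%E.

Definition upper_stable (R : realType) (Y : metricType R) : Prop :=
  exists Ku : R, 0 < Ku /\ K_upper_stable Y Ku.

(* The moduli $\rho_\varphi$, $\omega_\varphi$ of a map $\varphi : D \to Y$
   defined on a subset D of a normed space X with the norm distance; the values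
   of phi outside D are irrelevant. They are extended-real valued: inf of the
   empty set is +oo, and omega may be infinite. *)
Section Moduli.
Context (R : realType) (X : normedModType R) (Y : metricType R).
Variables (D : set X) (phi : X -> Y).

Definition rho (t : R) : \bar R :=
  ereal_inf [set z | exists x y, [/\ D x, D y, t <= `|x - y|
                                   & z = (mdist (phi x) (phi y))%:E]].

Definition omega (t : R) : \bar R :=
  ereal_sup [set z | exists x y, [/\ D x, D y, `|x - y| <= t
                                   & z = (mdist (phi x) (phi y))%:E]].

Definition coarse_embedding : Prop :=
  rho t @[t --> +oo%R] --> +oo%E /\
  (forall t : R, 0 < t -> (omega t < +oo)%E).

Definition uniform_embedding : Prop :=
  omega t @[t --> 0^'+] --> 0%E /\
  (forall t : R, 0 < t -> (0 < rho t)%E).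

End Moduli.

Definition unit_ball (R : realType) (X : normedModType R) : set X :=
  [set x | `|x| <= 1].
Arguments unit_ball {R} X _.

(* Sequences are indexed from 0. *)
Section Sequences.
Context (R : realType) (X : normedModType R).
Variable x : nat -> X.

Definition closed_span : set X :=
  closure [set y | exists (k : nat) (a : 'I_k -> R), y = \sum_(i < k) a i *: x i].

(* x is a Schauder basis of its closed linear span. *)
Definition basic_sequence : Prop :=
  forall y : X, closed_span y ->
    exists! a : nat -> R, (\sum_(0 <= i < n) a i *: x i) @[n --> \oo] --> y.

Definition spreading : Prop :=
  exists As Bs : R, [/\ 1 <= As, 1 <= Bs &
    forall (k : nat) (a : 'I_k -> R) (m : k.-tuple nat),
      (1 <= k)%N -> incr_tuples setT k m ->
      Bs^-1 * `|\sum_(i < k) a i *: x i| <= `|\sum_(i < k) a i *: x (tnth m i)|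
      /\ `|\sum_(i < k) a i *: x (tnth m i)| <= As * `|\sum_(i < k) a i *: x i|].

Definition unconditional : Prop :=
  exists Cu : R, 1 <= Cu /\
    forall (k : nat) (a eps : 'I_k -> R),
      (1 <= k)%N -> (forall i, eps i = -1 \/ eps i = 1) ->
      Cu^-1 * `|\sum_(i < k) a i *: x i| <= `|\sum_(i < k) (eps i * a i) *: x i|
      /\ `|\sum_(i < k) (eps i * a i) *: x i| <= Cu * `|\sum_(i < k) a i *: x i|.

End Sequences.

(* Main.v *)
Require Import Defs.
From mathcomp Require Import all_boot all_order all_algebra all_fingroup.
From mathcomp Require Import all_classical all_reals all_analysis.
From mathcomp Require Import zify ring lra.

(** Write [S a] for the sum of the [a i *: x i], and [S_A a] for the part of it
    over a set [A] of indices.  Unconditionality amounts to a bound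
    [`|S_A a| <= T * `|S a|] with [T] independent of [a] and [A], since a change
    of signs sends [S a] to [2 *: S_A a - S a], where [A] is the set of unchanged
    signs.

    Let [pi] list first the elements of [A] and then those of its complement,
    each in increasing order, and let [f] and [g] map tuples to the [phi]-images
    of the [A]-part of the sum and of minus its complementary part, both spread
    along the tuple.  When the indices are interlaced as in [S a], the arguments
    of [phi] differ by a spread copy of [S a], so their images are at distance at
    most [omega (C * `|S a|)].  When all the indices of [f] come before those of
    [g], the difference of the arguments is a vector whose initial projection is
    a spread copy of [S_A a]; as the initial projections are bounded, its norm
    is at least a multiple of [`|S_A a|], so that the images are at distance
    at least [rho (c * `|S_A a|)].  Upper stability compares the two,
    [rho (c * `|S_A a|) <= Ku * omega (C * `|S a|)], which by homogeneity bounds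
    [`|S_A a|] as soon as [Ku * omega (C * eta) < rho (delta / L)] for some
    positive [eta] and [delta] ([block_bound]).  Such a gap exists at a large
    scale for a coarse embedding ([coarse_gap]) and at a small scale for a
    uniform embedding of the ball ([uniform_gap]).

    The boundedness of the initial projections of a basic sequence
    ([basis_constant]) has a short proof for a spreading one.  Two spreads of
    [S a] which differ only in the position of the [p]-th term differ by
    [a p *: (x p.+1 - x p)], whence the coordinates are bounded
    ([coordinate_bound]).  If the projections were unbounded, one could
    concatenate spread blocks with summable norms which have initial segments of
    norm 1; the coordinates of the sum of these blocks would have to be the
    concatenated coefficients, whose partial sums diverge. *)

Set Implicit Arguments.
Unset Strict Implicit.
Unset Printing Implicit Defensive.

Import Order.TTheory GRing.Theory Num.Theory.
Import numFieldNormedType.Exports.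

Local Open Scope classical_set_scope.
Local Open Scope ring_scope.

(** * Spreading sequences *)

(** [x] is [C]-spreading: every spread copy of a finite linear combination of
    the first terms has the same norm up to a factor [C].  The positions are
    given by a strictly increasing function, and empty combinations are
    allowed. *)
Definition spreading_with (R : realType) (X : normedModType R) (C : R)
    (x : nat -> X) : Prop :=
  forall (k : nat) (a : 'I_k -> R) (m : 'I_k -> nat),
    {homo m : i j / (i < j)%N} ->
    `|\sum_(i < k) a i *: x (m i)| <= C * `|\sum_(i < k) a i *: x i| /\
    `|\sum_(i < k) a i *: x i| <= C * `|\sum_(i < k) a i *: x (m i)|.

Lemma spreading_withP (R : realType) (X : normedModType R) (x : nat -> X) :
  spreading x -> exists2 C : R, 1 <= C & spreading_with C x.
Proof.
move=> [A [B [A1 B1 AB]]]; exists (Num.max A B); first by rewrite le_max A1.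
move=> [|k] a m mi; first by rewrite !big_ord0 normr0 mulr0.
have mE i : tnth [tuple m i | i < k.+1] i = m i by rewrite tnth_mktuple.
have [||lo up] := AB _ a [tuple m i | i < k.+1].
- by [].
- split=> //; apply/(sortedP 0%N) => i; rewrite size_tuple => ik.
  have ik' := ltnW ik.
  rewrite -(tnth_nth _ _ (Ordinal ik)) -(tnth_nth _ _ (Ordinal ik')) !mE.
  exact: mi.
have E : \sum_(i < k.+1) a i *: x (tnth [tuple m i | i < k.+1] i) =
    \sum_(i < k.+1) a i *: x (m i) by apply: eq_bigr => i _; rewrite mE.
rewrite E in lo up.
split.
  by apply: le_trans up _; rewrite ler_wpM2r// le_max lexx.
move: lo; rewrite ler_pdivrMl; last by lra.
move/le_trans; apply; rewrite ler_wpM2r// le_max lexx orbT//.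
Qed.

(** The spreads of [a] along the two maps skipping [p], respectively [p.+1],
    differ only in their [p]-th terms. *)
Lemma coordinate_bound (R : realType) (X : normedModType R) (C : R)
    (x : nat -> X) (a : nat -> R) (p n : nat) :
  spreading_with C x -> (p < n)%N ->
  `|a p| * `|x p.+1 - x p| <= 2 * C * `|\sum_(i < n) a i *: x i|.
Proof.
move=> sp pn.
have [|h1 _] := sp n (fun i => a i) (fun i => i + (p < i))%N; first by move=> i j; lia.
have [|h2 _] := sp n (fun i => a i) (fun i => i + (p <= i))%N; first by move=> i j; lia.
have -> : `|a p| * `|x p.+1 - x p| =
   `|\sum_(i < n) a i *: x (i + (p <= i))%N - \sum_(i < n) a i *: x (i + (p < i))%N|.
  rewrite -sumrB (bigD1 (Ordinal pn))//= leqnn ltnn addn1 addn0 big1 ?addr0.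
    by rewrite -scalerBr normrZ.
  move=> i ip; rewrite [(p <= i)%N]leq_eqVlt.
  have -> : (p == i) = false by apply: contra_neqF ip => /eqP pi; apply: val_inj.
  by rewrite subrr.
by apply: le_trans (ler_normB _ _) _; lra.
Qed.

(** * Initial projections of a spreading basic sequence *)

(** Sequences [a j] of respective lengths [n j] can be put end to end. *)
Lemma concatenation (T : pointedType) (n : nat -> nat) (a : nat -> nat -> T) :
  exists d : nat -> T, forall j i, (i < n j)%N ->
    d (\sum_(k < j) n k + i)%N = a j i.
Proof.
set N := fun j => (\sum_(k < j) n k)%N.
have NS j : N j.+1 = (N j + n j)%N by rewrite /N big_ord_recr.
have Nm j j' : (j <= j')%N -> (N j <= N j')%N.
  by move/subnK<-; elim: (j' - j)%N => // k IH; rewrite addSn NS; lia.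
have /choice[d dP] : forall p, exists v, forall j i, (i < n j)%N ->
    p = (N j + i)%N -> v = a j i.
  move=> p.
  have [[[j i] [ij ->]]|no] := pselect (exists ji, (ji.2 < n ji.1)%N /\
    p = (N ji.1 + ji.2)%N).
    exists (a j i) => j' i' ij' /= e; rewrite /= in ij.
    have jj : j = j'.
      have [lt|lt|//] := ltngtP j j'; have := Nm _ _ lt; rewrite NS; lia.
    by subst j'; congr a; lia.
  by exists point => j i ij e; case: no; exists (j, i).
by exists d => j i ij; apply: dP.
Qed.

(** By contradiction: [a j], [l j] and [n j] are the coefficients, the initial
    length and the total length of a block whose full sum has norm at most
    [2^-j], although its initial sum has norm 1. *)
Lemma basis_constant_nat (R : realType) (X : completeNormedModType R) (C : R)
    (x : nat -> X) :
  1 <= C -> spreading_with C x -> basic_sequence x ->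
  exists K : R, 1 <= K /\ forall (l n : nat) (a : nat -> R), (l <= n)%N ->
    `|\sum_(i < l) a i *: x i| <= K * `|\sum_(i < n) a i *: x i|.
Proof.
move=> C1 sp bs; apply: contrapT => noK.
have C0 : 0 < C by lra.
pose S (a : nat -> R) n := \sum_(i < n) a i *: x i.
have bad j : exists t : (nat -> R) * nat * nat, [/\ (t.1.2 <= t.2)%N,
    `|S t.1.1 t.1.2| = 1 & `|S t.1.1 t.2| <= 2^-1 ^+ j].
  apply: contrapT => noj; apply: noK; exists (2 ^+ j); split.
    by rewrite exprn_ege1// ler1n.
  move=> l n a ln; rewrite leNgt; apply/negP => lt; apply: noj.
  have s0 : 0 < `|S a l|.
    by apply: le_lt_trans lt; rewrite mulr_ge0// exprn_ge0.
  have SZ k : S (fun i => `|S a l|^-1 * a i) k = `|S a l|^-1 *: S a k.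
    by rewrite scaler_sumr; apply: eq_bigr => i _; rewrite scalerA.
  exists (fun i => `|S a l|^-1 * a i, l, n); split => //=; rewrite SZ normrZ.
    by rewrite normfV normr_id mulVf// gt_eqF.
  rewrite normfV normr_id ler_pdivrMl// -[leLHS]mul1r.
  by rewrite exprVn ler_pdivlMr ?exprn_gt0// mul1r mulrC ltW.
have [t tP] := choice bad.
pose a j := (t j).1.1; pose l j := (t j).1.2; pose n j := (t j).2.
have ln j : (l j <= n j)%N by case: (tP j).
have Sl j : `|S (a j) (l j)| = 1 by case: (tP j).
have Sn j : `|S (a j) (n j)| <= 2^-1 ^+ j by case: (tP j).
have [d dE] := concatenation n a.
pose N j := (\sum_(k < j) n k)%N.
have n0 j : (0 < n j)%N.
  have := Sl j; have := ln j; case: (l j) => [_|k]; last by lia.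
  by rewrite /S big_ord0 normr0 => /eqP; rewrite eq_sym oner_eq0.
have NS j : N j.+1 = (N j + n j)%N by rewrite /N big_ord_recr.
have Nge j : (j <= N j)%N by elim: j => // j IH; rewrite NS; have := n0 j; lia.
pose u j k := \sum_(i < k) a j i *: x (N j + i)%N.
have SN j k : (k <= n j)%N -> S d (N j + k) = S d (N j) + u j k.
  move=> kn; rewrite /S big_split_ord/=; congr (_ + _).
  by apply: eq_bigr => i _; rewrite dE// (leq_trans (ltn_ord i)).
have uP j k : `|u j k| <= C * `|S (a j) k| /\ `|S (a j) k| <= C * `|u j k|.
  by apply: (sp k (fun i => a j i) (fun i => N j + i)%N) => i i'; rewrite ltn_add2l.
pose U j := u j (n j).
have SU j : S d (N j) = series U j.
  elim: j => [|j IH]; first by rewrite /series/= /S /N !(big_ord0, big_geq).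
  by rewrite NS SN// IH seriesSr.
(* The block [u j (n j)] is a spread copy of [S (a j) (n j)]. *)
have cU : cvgn (series U).
  apply: normed_cvg.
  apply: (@series_le_cvg _ _ (geometric C 2^-1)).
  - by move=> j; rewrite normr_ge0.
  - by move=> j; rewrite /= mulr_ge0// ?exprn_ge0// ltW.
  - by move=> j /=; have [h _] := uP j (n j); apply: le_trans h _; rewrite ler_wpM2l// ltW.
  - by apply: is_cvg_geometric_series; rewrite ger0_norm; lra.
pose y := limn (series U).
have yS : S d (N j) @[j --> \oo] --> y.
  by rewrite (_ : (fun j => S d (N j)) = series U)//; apply/funext => j.
have ycs : closed_span x y.
  move=> B yB; have [j _ jB] := yS _ yB; have /= BS := jB j (leqnn j).
  by exists (S d (N j)); split=> //; exists (N j), (fun i => d i).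
(* If [x p = x p.+1], then 0 has two expansions: the trivial one and the
   one with coefficients 1 at [p] and -1 at [p.+1]. *)
have distinct p : x p.+1 - x p != 0.
  apply/negP => /eqP/subr0_eq e.
  have [|c [_ cU0]] := bs 0.
    move=> B B0; exists 0; split; last exact: nbhs_singleton.
    by exists 0%N, (fun=> 0); rewrite big_ord0.
  pose e1 i : R := (i == p)%:R - (i == p.+1)%:R.
  have : c = (fun=> 0).
    apply: cU0; rewrite (_ : (fun n : nat => _) = fun=> 0); first exact: cvg_cst.
    by apply/funext => k; rewrite big1// => i _; rewrite scale0r.
  have -> : c = e1.
    apply: cU0; apply: cvg_near_cst; exists p.+2 => // k /= pk.
    have pick q : (q < k)%N -> \sum_(0 <= i < k) (i == q)%:R *: x i = x q.
      move=> qk; rewrite big_mkord (bigD1 (Ordinal qk))//= eqxx scale1r big1 ?addr0//.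
      move=> i iq; rewrite (_ : (i == q :> nat) = false) ?scale0r//.
      by apply: contra_neqF iq => /eqP qi; apply: val_inj.
    under eq_bigr do rewrite scalerBl.
    by rewrite sumrB !pick ?e ?subrr//; lia.
  move/(congr1 (@^~ p)); rewrite /e1 eqxx (_ : p == p.+1 = false); last by lia.
  by rewrite subr0 => /eqP; rewrite oner_eq0.
have [c [cy _]] := bs y ycs.
have cS : S c k @[k --> \oo] --> y.
  by rewrite (_ : S c = fun k => \sum_(0 <= i < k) c i *: x i)//; apply/funext => k; rewrite big_mkord.
have Noo : N j @[j --> \oo] --> \oo.
  move=> B [k _ kB]; exists k => // j /= kj; apply: kB => /=.
  exact: leq_trans (Nge j).
(* The partial sums of [d] and [c] both tend to [y] along [N], so that
   [coordinate_bound] applies to the coefficients [d - c]. *)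
have dc : d = c.
  apply/funext => p; apply/eqP; rewrite -subr_eq0; apply: contraT => dcp.
  pose e := `|d p - c p| * `|x p.+1 - x p| / (2 * C).
  have e0 : 0 < e by rewrite !(divr_gt0, mulr_gt0)// normr_gt0.
  have dcS : S d (N j) - S c (N j) @[j --> \oo] --> y - y.
    by apply: cvgB => //; exact: (cvg_comp _ _ Noo cS).
  rewrite subrr in dcS.
  have [j0 _ hj] := (cvgr0Pnorm_lt _).1 dcS _ e0.
  have := hj (maxn j0 p.+1) (leq_maxl _ _).
  rewrite /S -sumrB ltNge => /negP[]; rewrite ler_pdivrMr ?mulr_gt0//.
  under eq_bigr do rewrite -scalerBl.
  rewrite [leRHS]mulrC (coordinate_bound (fun i => d i - c i) sp)//.
  exact: leq_trans (leq_maxr _ _) (Nge _).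
(* The partial sums of [d] are therefore Cauchy, while [u j (l j)] is a
   difference of two of them with norm at least [C^-1]. *)
have Ci : 0 < C^-1 / 2 by rewrite divr_gt0 ?invr_gt0.
rewrite -dc in cS.
have [k0 _ hk] := (cvgrPdist_lt _ _).1 cS _ Ci.
have h1 := hk (N k0) (Nge k0).
have h2 := hk (N k0 + l k0)%N (leq_trans (Nge k0) (leq_addr _ _)).
have [_] := uP k0 (l k0); rewrite Sl -ler_pdivrMl// mulr1 leNgt => /negP; apply.
have -> : u k0 (l k0) = (y - S d (N k0)) - (y - S d (N k0 + l k0)).
  by rewrite SN// opprB addrC addrA subrK addrC addKr.
by apply: le_lt_trans (ler_normB _ _) _; lra.
Qed.

(** The projections onto the first terms are bounded by [K], uniformly: [K] is a
    bound for the basis constant of [x]. *)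
Definition initial_projections_bounded (R : realType) (X : normedModType R)
    (K : R) (x : nat -> X) : Prop :=
  forall (l m : nat) (b : 'I_(l + m) -> R),
    `|\sum_(i < l) b (lshift m i) *: x i| <= K * `|\sum_(i < l + m) b i *: x i|.

Lemma basis_constant (R : realType) (X : completeNormedModType R) (C : R)
    (x : nat -> X) :
  1 <= C -> spreading_with C x -> basic_sequence x ->
  exists2 K : R, 1 <= K & initial_projections_bounded K x.
Proof.
move=> C1 sp bs; have [K [K1 KP]] := basis_constant_nat C1 sp bs.
exists K => // l m b.
pose a i := oapp b 0 (insub i).
have aE (i : 'I_(l + m)) : a i = b i by rewrite /a valK.
have -> : \sum_(i < l) b (lshift m i) *: x i = \sum_(i < l) a i *: x i.
  by apply: eq_bigr => i _; rewrite -aE.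
have -> : \sum_(i < l + m) b i *: x i = \sum_(i < l + m) a i *: x i.
  by apply: eq_bigr => i _; rewrite aE.
by apply: KP; rewrite leq_addr.
Qed.

(** * Sorting a set of indices to the front *)

Lemma enum_val_homo (k : nat) (A : {set 'I_k}) :
  {homo (@enum_val _ (mem A)) : i j / (i < j)%N}.
Proof.
move=> i j ij; have x0 := enum_val i.
rewrite !(enum_val_nth x0).
have so : sorted (relpre val ltn) (enum A).
  rewrite /enum_mem; apply: sorted_filter; first by move=> ? ? ?; apply: ltn_trans.
  by rewrite -enumT -sorted_map val_enum_ord iota_ltn_sorted.
have tr : transitive (relpre (val : 'I_k -> nat) ltn) by move=> ? ? ?; apply: ltn_trans.
by apply: (sorted_ltn_nth tr) => //; rewrite inE -cardE.
Qed.

(** The permutation listing first [A], then its complement, in increasing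
    order. *)
Lemma block_permutation (k : nat) (A : {set 'I_k}) :
  exists (l m : nat) (e : (l + m)%N = k) (pi : 'S_(l + m)),
    [/\ order_preserving_on_blocks pi,
        forall i, cast_ord e (pi (lshift m i)) \in A
      & forall j, cast_ord e (pi (rshift l j)) \notin A].
Proof.
have e : (#|A| + #|~: A|)%N = k by rewrite cardsC card_ord.
exists #|A|, #|~: A|, e.
pose h (i : 'I_(#|A| + #|~: A|)) : 'I_k :=
  match fintype.split i with inl i => enum_val i | inr j => enum_val j end.
have hl i : h (lshift _ i) = enum_val i.
  by rewrite /h (unsplitK (inl i : 'I_#|A| + 'I_#|~: A|)%type).
have hr j : h (rshift _ j) = enum_val j.
  by rewrite /h (unsplitK (inr j : 'I_#|A| + 'I_#|~: A|)%type).
have lA (i : 'I_#|A|) : enum_val i \in A by exact: enum_valP.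
have rA (j : 'I_#|~: A|) : enum_val j \notin A.
  by have := enum_valP j; rewrite inE.
have hI : injective h.
  move=> i j; case: (split_ordP i) => i' ->; case: (split_ordP j) => j' ->;
    rewrite ?hl ?hr.
  - by move/enum_val_inj ->.
  - by move=> E; have := lA i'; rewrite E (negbTE (rA j')).
  - by move=> E; have := lA j'; rewrite -E (negbTE (rA i')).
  - by move/enum_val_inj ->.
have cI : injective (cast_ord (esym e) \o h).
  by apply: inj_comp hI; exact: cast_ord_inj.
exists (perm cI); split; [split| |].
- by move=> i j ij; rewrite !permE /= !hl; apply: enum_val_homo.
- by move=> i j ij; rewrite !permE /= !hr; apply: enum_val_homo.
- by move=> i; rewrite permE /= cast_ordKV hl.
- by move=> j; rewrite permE /= cast_ordKV hr.
Qed.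

(** * Bounding blocks by upper stability *)

Lemma incr_tuple_homo (M : set nat) (k : nat) (s : k.-tuple nat) :
  incr_tuples M k s -> {homo tnth s : i j / (i < j)%N}.
Proof.
move=> [so _] i j ij; rewrite !(tnth_nth 0%N).
by apply: (sorted_ltn_nth ltn_trans) => //; rewrite inE size_tuple.
Qed.

(** The heart of the argument.  Under the gap hypothesis, a block of norm [delta]
    cannot be part of a combination of norm at most [eta].  The radius
    [C * (C * (eta + C * delta))] bounds all the arguments given to [phi]:
    spreads of the block and of the complementary combination. *)
Lemma block_bound_normalized (R : realType) (X : normedModType R)
    (Y : metricType R) (Ku C K delta eta B : R) (D : set X) (phi : X -> Y)
    (x : nat -> X) (l m : nat) (pi : 'S_(l + m)) (a : 'I_(l + m) -> R) :
  0 < Ku -> K_upper_stable Y Ku ->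
  1 <= C -> spreading_with C x ->
  1 <= K -> initial_projections_bounded K x ->
  0 < delta -> 0 < eta ->
  order_preserving_on_blocks pi ->
  (forall v, `|v| <= C * (C * (eta + C * delta)) -> D v) ->
  (forall v w, `|v| <= C * (C * (eta + C * delta)) ->
               `|w| <= C * (C * (eta + C * delta)) ->
               mdist (phi v) (phi w) <= B) ->
  (Ku%:E * omega D phi (C * eta) < rho D phi (delta / (C * K)))%E ->
  `|\sum_(i < l) a (pi (lshift m i)) *: x i| = delta ->
  eta < `|\sum_(i < l + m) a i *: x i|.
Proof.
move=> Ku0 us C1 sp K1 pj d0 e0 opi DP BP gap nd; rewrite ltNge; apply/negP => ne.
have C0 : 0 < C by lra.
have K0 : 0 < K by lra.
have l1 : (1 <= l)%N.
  rewrite lt0n; apply: contraTneq d0 => l0; rewrite -nd big1 ?normr0 ?ltxx//.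
  by move=> i; have := ltn_ord i; lia.
pose b i := a (pi i).
have split_sum (y : 'I_(l + m) -> X) :
    \sum_(i < l) b (lshift m i) *: y (lshift m i) +
    \sum_(j < m) b (rshift l j) *: y (rshift l j) = \sum_i b i *: y i.
  by rewrite big_split_ord.
have reind (y : 'I_(l + m) -> X) : \sum_i b i *: y (pi i) = \sum_i a i *: y i.
  by rewrite [RHS](reindex_inj (@perm_inj _ pi)).
have Cd : C * delta <= C * (C * (eta + C * delta)).
  rewrite ler_wpM2l ?(ltW C0)//.
  have h : C * delta <= C * (C * delta).
    by rewrite -[leLHS]mul1r ler_wpM2r// mulr_ge0 ?ltW.
  have h' : delta <= C * delta by rewrite -[leLHS]mul1r ler_wpM2r// ltW.
  by have := mulr_gt0 C0 e0; lra.
pose u (s : l.-tuple nat) := \sum_(i < l) b (lshift m i) *: x (tnth s i).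
pose v (t : m.-tuple nat) := - \sum_(j < m) b (rshift l j) *: x (tnth t j).
have ub s : incr_tuples setT l s -> `|u s| <= C * (C * (eta + C * delta)).
  move=> /incr_tuple_homo si; apply: le_trans Cd.
  by rewrite -nd; have [] := sp l (fun i => b (lshift m i)) _ si.
have vb t : incr_tuples setT m t -> `|v t| <= C * (C * (eta + C * delta)).
  move=> /incr_tuple_homo ti; rewrite /v normrN.
  have [h _] := sp m (fun j => b (rshift l j)) _ ti.
  apply: le_trans h _; rewrite ler_wpM2l ?(ltW C0)//.
  have [_ h] := sp m (fun j => b (rshift l j)) (fun j => pi (rshift l j)) opi.2.
  apply: le_trans h _; rewrite ler_wpM2l ?(ltW C0)//.
  have [h _] := sp l (fun i => b (lshift m i)) (fun i => pi (lshift m i)) opi.1.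
  rewrite nd in h.
  have -> : \sum_(j < m) b (rshift l j) *: x (pi (rshift l j)) =
      \sum_i a i *: x i - \sum_(i < l) b (lshift m i) *: x (pi (lshift m i)).
    by rewrite -(reind (fun i => x i)) -(split_sum (fun i => x (pi i))) addrC addKr.
  by apply: le_trans (ler_normB _ _) _; rewrite lerD.
have fb : bounded_incr_map (phi \o u) by exists B => s t /ub ? /ub ?; exact: BP.
have gb : bounded_incr_map (phi \o v) by exists B => s t /vb ? /vb ?; exact: BP.
have uv (n : (l + m).-tuple nat) (h : 'I_l -> 'I_(l + m)) (h' : 'I_m -> 'I_(l + m)) :
    u (subtuple n h) - v (subtuple n h') =
    \sum_(i < l) b (lshift m i) *: x (tnth n (h i)) +
    \sum_(j < m) b (rshift l j) *: x (tnth n (h' j)).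
  rewrite /u /v opprK; congr (_ + _); apply: eq_bigr => i _; by rewrite tnth_mktuple.
have sub_incr k (n : (l + m).-tuple nat) (h : 'I_k -> 'I_(l + m)) :
    {homo h : i j / (i < j)%N} -> incr_tuples setT (l + m)%N n ->
    incr_tuples setT k (subtuple n h).
  move=> hh /incr_tuple_homo ni; split=> //; case: k h hh => [|k] h hh.
    by rewrite tuple0.
  apply/(sortedP 0%N) => i; rewrite size_tuple => ik.
  rewrite -(tnth_nth _ _ (Ordinal ik)) -(tnth_nth _ _ (Ordinal (ltnW ik))) !tnth_mktuple.
  by apply/ni/hh.
(* Upper stability contradicts the gap: the supremum is at most
   [omega (C * eta)], and the infimum is at least [rho (delta / (C * K))]. *)
have := us l m pi l1 opi _ _ fb gb setT infinite_nat.
apply/negP; rewrite -ltNge.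
apply: (@le_lt_trans _ _ (Ku%:E * omega D phi (C * eta))%E).
  apply: lee_wpmul2l; first by rewrite lee_fin ltW.
  apply: ge_ereal_sup => _ [n nM <-].
  apply: ereal_sup_ubound.
  exists (u (subtuple n (fun i => pi (lshift m i)))), (v (subtuple n (fun j => pi (rshift l j)))).
  split=> //.
  - by apply/DP/ub/sub_incr => //; case: opi.
  - by apply/DP/vb/sub_incr => //; case: opi.
  rewrite uv (split_sum (fun i => x (tnth n (pi i)))) (reind (fun i => x (tnth n i))).
  have [h _] := sp _ a _ (incr_tuple_homo nM).
  by apply: le_trans h _; rewrite ler_wpM2l// ltW.
apply: lt_le_trans gap _.
apply: le_ereal_inf_tmp => _ [n nM <-].
apply: ereal_inf_lbound.
exists (u (subtuple n (lshift m))), (v (subtuple n (@rshift l m))).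
split=> //.
- by apply/DP/ub/sub_incr.
- by apply/DP/vb/sub_incr => // i j /=; rewrite ltn_add2l.
rewrite uv (split_sum (fun i => x (tnth n i))) ler_pdivrMr ?mulr_gt0//.
have [_ h] := sp _ b _ (incr_tuple_homo nM).
have := pj l m b; rewrite nd => /le_trans; apply.
by rewrite [leRHS]mulrC [C * K]mulrC -mulrA ler_wpM2l// ltW.
Qed.

(** Any block can be scaled to have norm [delta]. *)
Lemma block_bound (R : realType) (X : normedModType R)
    (Y : metricType R) (Ku C K delta eta B : R) (D : set X) (phi : X -> Y)
    (x : nat -> X) (l m : nat) (pi : 'S_(l + m)) (a : 'I_(l + m) -> R) :
  0 < Ku -> K_upper_stable Y Ku ->
  1 <= C -> spreading_with C x ->
  1 <= K -> initial_projections_bounded K x ->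
  0 < delta -> 0 < eta ->
  order_preserving_on_blocks pi ->
  (forall v, `|v| <= C * (C * (eta + C * delta)) -> D v) ->
  (forall v w, `|v| <= C * (C * (eta + C * delta)) ->
               `|w| <= C * (C * (eta + C * delta)) ->
               mdist (phi v) (phi w) <= B) ->
  (Ku%:E * omega D phi (C * eta) < rho D phi (delta / (C * K)))%E ->
  `|\sum_(i < l) a (pi (lshift m i)) *: x i| <=
    delta / eta * `|\sum_(i < l + m) a i *: x i|.
Proof.
move=> Ku0 us C1 sp K1 pj d0 e0 opi DP BP gap.
set s := `|_|; have [s0|s0] := eqVneq s 0.
  by rewrite s0 mulr_ge0// divr_ge0 ?ltW.
have sgt0 : 0 < s by rewrite lt_neqAle eq_sym s0 normr_ge0.
have c0 : 0 < delta / s by rewrite divr_gt0.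
have Z n (c : 'I_n -> R) (y : 'I_n -> X) :
    `|\sum_i (delta / s * c i) *: y i| = delta / s * `|\sum_i c i *: y i|.
  under eq_bigr do rewrite -scalerA.
  by rewrite -scaler_sumr normrZ gtr0_norm.
have := block_bound_normalized (a := fun i => delta / s * a i)
  Ku0 us C1 sp K1 pj d0 e0 opi DP BP gap.
rewrite !Z -/s divfK// => /(_ erefl) h.
rewrite -mulrAC ler_pdivlMr// mulrC -ler_pdivlMr//.
by rewrite ltW// mulrAC.
Qed.

(** * Unconditionality *)

Lemma unconditional_of_block_bound (R : realType) (X : normedModType R)
    (x : nat -> X) (T : R) :
  0 <= T ->
  (forall (l m : nat) (pi : 'S_(l + m)) (a : 'I_(l + m) -> R),
    order_preserving_on_blocks pi ->
    `|\sum_(i < l) a (pi (lshift m i)) *: x (pi (lshift m i))| <=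
      T * `|\sum_(i < l + m) a i *: x i|) ->
  unconditional x.
Proof.
move=> T0 bl.
have sub k (a : 'I_k -> R) (A : {set 'I_k}) :
    `|\sum_(i in A) a i *: x i| <= T * `|\sum_i a i *: x i|.
  have [l [m [e [pi [opi pA pnA]]]]] := block_permutation A.
  subst k.
  have -> : \sum_(i in A) a i *: x i =
      \sum_(i < l) a (pi (lshift m i)) *: x (pi (lshift m i)); last exact: bl.
  rewrite (reindex_inj (@perm_inj _ pi)) big_split_ord/=.
  rewrite [X in _ + X]big1 ?addr0.
    by apply: eq_bigl => i; have := pA i; rewrite cast_ord_id.
  by move=> j; have := pnA j; rewrite cast_ord_id => /negbTE ->.
have sgn k (a eps : 'I_k -> R) : (forall i, eps i = -1 \/ eps i = 1) ->
    `|\sum_i (eps i * a i) *: x i| <= (2 * T + 1) * `|\sum_i a i *: x i|.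
  move=> epsP; pose A := [set i | eps i == 1]%SET.
  have -> : \sum_i (eps i * a i) *: x i =
      2 *: (\sum_(i in A) a i *: x i) - \sum_i a i *: x i.
    rewrite [in RHS]big_mkcond scaler_sumr -sumrB; apply: eq_bigr => i _.
    rewrite inE; have [->|->] := epsP i.
      rewrite (_ : (-1 == 1 :> R) = false); first by rewrite scaler0 sub0r mulN1r scaleNr.
      by apply/negbTE/eqP; lra.
    by rewrite eqxx mul1r scaler_nat mulr2n addrK.
  apply: le_trans (ler_normB _ _) _; rewrite normrZ ger0_norm//.
  by have := sub k a A; lra.
exists (2 * T + 1); split; first by lra.
move=> k a eps _ epsP; split; last exact: sgn.
rewrite ler_pdivrMl; last by lra.
have := sgn k (fun i => eps i * a i) eps epsP.
congr (`|_| <= _); apply: eq_bigr => i _; rewrite mulrA.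
by have [->|->] := epsP i; rewrite ?mulrNN mulr1 mul1r.
Qed.

(** The constants are quantified so that the gap only concerns the embedding:
    [C] is the spreading constant, and [L] absorbs the basis constant. *)
Lemma unconditional_of_gap (R : realType) (X : completeNormedModType R)
    (Y : metricType R) (D : set X) (phi : X -> Y) (x : nat -> X) :
  upper_stable Y -> basic_sequence x -> spreading x ->
  (forall Ku C L : R, 0 < Ku -> 1 <= C -> 1 <= L ->
    exists delta eta B : R, [/\ 0 < delta, 0 < eta,
      (forall v, `|v| <= C * (C * (eta + C * delta)) -> D v),
      (forall v w, `|v| <= C * (C * (eta + C * delta)) ->
                   `|w| <= C * (C * (eta + C * delta)) ->
                   mdist (phi v) (phi w) <= B)
    & (Ku%:E * omega D phi (C * eta) < rho D phi (delta / L))%E]) ->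
  unconditional x.
Proof.
move=> [Ku [Ku0 us]] bs /spreading_withP[C C1 sp] gap.
have [K K1 pj] := basis_constant C1 sp bs.
have L1 : 1 <= C * K by rewrite -[leLHS]mulr1 ler_pM.
have [delta [eta [B [d0 e0 DP BP g]]]] := gap _ _ _ Ku0 C1 L1.
apply: (@unconditional_of_block_bound _ _ _ (C * (delta / eta))).
  by rewrite mulr_ge0 ?divr_ge0 ?ltW//; lra.
move=> l m pi a opi.
have [h _] := sp l (fun i => a (pi (lshift m i))) (fun i => pi (lshift m i)) opi.1.
apply: le_trans h _; rewrite -mulrA ler_wpM2l//; first by lra.
exact: (block_bound a Ku0 us C1 sp K1 pj d0 e0 opi DP BP g).
Qed.

(** * The gap for coarse and for uniform embeddings *)

Lemma le_omega (R : realType) (X : normedModType R)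
    (Y : metricType R) (D : set X) (phi : X -> Y) (s t : R) :
  s <= t -> (omega D phi s <= omega D phi t)%E.
Proof.
move=> st; apply: ereal_sup_le => z [v [w [Dv Dw vw ->]]].
by exists v, w; split=> //; exact: le_trans vw st.
Qed.

Lemma omega_lt_pinfty (R : realType) (X : normedModType R)
    (Y : metricType R) (D : set X) (phi : X -> Y) (t : R) :
  (omega D phi t < +oo)%E -> exists B : R, forall v w,
    D v -> D w -> `|v - w| <= t -> mdist (phi v) (phi w) <= B.
Proof.
move=> h; exists (fine (omega D phi t)) => v w Dv Dw vw.
have le : ((mdist (phi v) (phi w))%:E <= omega D phi t)%E.
  by apply: ereal_sup_ubound; exists v, w.
rewrite -lee_fin fineK//; apply/fin_numPlt; rewrite h andbT.
by apply: lt_le_trans le; rewrite ltNyr.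
Qed.

(** With [eta = 1], divergence of [rho] at infinity provides [delta]. *)
Lemma coarse_gap (R : realType) (X : normedModType R) (Y : metricType R)
    (phi : X -> Y) (Ku C L : R) :
  coarse_embedding setT phi -> 0 < Ku -> 1 <= C -> 1 <= L ->
  exists delta eta B : R, [/\ 0 < delta, 0 < eta,
      (forall v : X, `|v| <= C * (C * (eta + C * delta)) -> setT v),
      (forall v w, `|v| <= C * (C * (eta + C * delta)) ->
                   `|w| <= C * (C * (eta + C * delta)) ->
                   mdist (phi v) (phi w) <= B)
    & (Ku%:E * omega setT phi (C * eta) < rho setT phi (delta / L))%E].
Proof.
move=> [rhooo omoo] Ku0 C1 L1.
have C0 : 0 < C by lra.
have L0 : 0 < L by lra.
have om1 : (omega setT phi (C * 1) < +oo)%E by apply: omoo; lra.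
have [A AP] : exists A : R, (Ku%:E * omega setT phi (C * 1) <= A%:E)%E.
  have : (Ku%:E * omega setT phi (C * 1) < +oo)%E.
    move: om1; case: (omega _ _ _) => [r| |] _ //; first by rewrite -EFinM ltry.
    by rewrite gt0_muleNy ?lte_fin.
  case: (Ku%:E * _)%E => [r| |] // _; first by exists r.
  by exists 0; rewrite leNye.
have [c [c0 cA]] : exists c, 0 < c /\ (A%:E < rho setT phi c)%E.
  have [M [_ MP]] := (cvgeyPgt _).1 rhooo A.
  exists (Num.max 1 (M + 1)); split; first by rewrite lt_max ltr01.
  by apply: MP; rewrite lt_max ltrDl ltr01 orbT.
set r := C * (C * (1 + C * (c * L))).
have r0 : 0 < r by rewrite !mulr_gt0// addr_gt0// !mulr_gt0.
have r20 : 0 < 2 * r by rewrite mulr_gt0.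
have [B BP] := omega_lt_pinfty (omoo _ r20).
exists (c * L), 1, B; split => //; first by rewrite mulr_gt0.
- move=> v w vr wr; apply: BP => //.
  by apply: le_trans (ler_normB _ _) _; rewrite -/r in vr wr; lra.
- by rewrite mulfK ?gt_eqF//; exact: le_lt_trans AP cA.
Qed.

(** A uniform embedding need only have [omega t] finite for small [t]; the ball
    being convex, any of its points is joined to 0 by [N] steps of length at
    most [t], where [N > t^-1]. *)
Lemma uniform_bounded (R : realType) (X : normedModType R) (Y : metricType R)
    (phi : X -> Y) (t : R) :
  0 < t -> (omega (unit_ball X) phi t < +oo)%E ->
  exists B : R, forall v w, unit_ball X v -> unit_ball X w ->
    mdist (phi v) (phi w) <= B.
Proof.
move=> t0 /omega_lt_pinfty[B BP].
pose N := (Num.truncn t^-1).+1.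
have Nt : t^-1 < N%:R by rewrite Num.Theory.truncnS_gt.
have N0 : 0 < N%:R :> R by rewrite ltr0n.
have step v k : unit_ball X v -> (k <= N)%N ->
    mdist (phi 0) (phi ((k%:R / N%:R) *: v)) <= k%:R * B.
  move=> v1; elim: k => [|k IH] kN.
    by rewrite mul0r scale0r mul0r mdistxx.
  apply: le_trans (metric_triangle _ (phi ((k%:R / N%:R) *: v)) _) _.
  rewrite -[in leRHS]natr1 mulrDl mul1r lerD ?IH ?(ltnW kN)//.
  have inb i : (i <= N)%N -> unit_ball X ((i%:R / N%:R) *: v).
    move=> iN; rewrite /unit_ball/= normrZ ger0_norm ?divr_ge0//.
    rewrite -[leRHS]mulr1 ler_pM ?divr_ge0//.
    by rewrite ler_pdivrMr// mul1r ler_nat.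
  apply: BP; [exact: inb (ltnW kN)|exact: inb|].
  rewrite -scalerBl -mulrBl -[in X in _ - X]natr1 opprD addrA subrr sub0r mulN1r scaleNr normrN.
  rewrite normrZ ger0_norm ?invr_ge0//.
  apply: (@le_trans _ _ (N%:R^-1)).
    by rewrite -[leRHS]mulr1 ler_wpM2l ?invr_ge0.
  by rewrite -[leRHS]invrK lef_pV2 ?posrE ?invr_gt0// ltW.
exists (N%:R * B + N%:R * B) => v w v1 w1.
apply: le_trans (metric_triangle _ (phi 0) _) _.
rewrite metric_sym; have := step v N v1 (leqnn _); have := step w N w1 (leqnn _).
by rewrite divff ?gt_eqF// !scale1r => h1 h2; rewrite lerD.
Qed.

(** Here [delta] is fixed first, small enough for the relevant vectors to lie in
    the unit ball; then the convergence of [omega] to 0 provides [eta]. *)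
Lemma uniform_gap (R : realType) (X : normedModType R) (Y : metricType R)
    (phi : X -> Y) (Ku C L : R) :
  uniform_embedding (unit_ball X) phi -> 0 < Ku -> 1 <= C -> 1 <= L ->
  exists delta eta B : R, [/\ 0 < delta, 0 < eta,
      (forall v : X, `|v| <= C * (C * (eta + C * delta)) -> unit_ball X v),
      (forall v w, `|v| <= C * (C * (eta + C * delta)) ->
                   `|w| <= C * (C * (eta + C * delta)) ->
                   mdist (phi v) (phi w) <= B)
    & (Ku%:E * omega (unit_ball X) phi (C * eta) <
       rho (unit_ball X) phi (delta / L))%E].
Proof.
move=> [om0 rhop] Ku0 C1 L1.
have C0 : 0 < C by lra.
have L0 : 0 < L by lra.
pose delta := (2 * C * C * C)^-1.
have d0 : 0 < delta by rewrite invr_gt0 !mulr_gt0.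
have [q q0 qrho] : exists2 q : R, 0 < q & (q%:E < rho (unit_ball X) phi (delta / L))%E.
  have := rhop (delta / L) (divr_gt0 d0 L0).
  case: (rho _ _ _) => [r| |]// h; last by exists 1 => //; rewrite ltry.
  by exists (r / 2); rewrite ?lte_fin in h *; lra.
have om_lt e : 0 < e -> exists2 s, 0 < s & (omega (unit_ball X) phi s < e%:E)%E.
  move=> e0.
  have /om0 om0e : nbhs (0%E : \bar R) (fun z => (z < e%:E)%E).
    by apply: open_ereal_lt'; rewrite lte_fin.
  have h : \forall s \near (0:R)^'+, (omega (unit_ball X) phi s < e%:E)%E.
    exact: om0e.
  have h' : \forall s \near (0:R)^'+, 0 < s by exact: nbhs_right_gt.
  have [s [? ?]] := @filter_ex _ _ (at_right_proper_filter (0 : R)) _ (filterI h h').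
  by exists s.
have [s1 s10 s1q] := om_lt (q / Ku) (divr_gt0 q0 Ku0).
have [|B BP] := @uniform_bounded _ _ _ phi s1 s10; first by rewrite (lt_trans s1q)// ltry.
pose eta := Num.min (s1 / C) (2 * C * C)^-1.
have e0 : 0 < eta by rewrite lt_min divr_gt0//= invr_gt0 !mulr_gt0.
have inb (v : X) : `|v| <= C * (C * (eta + C * delta)) -> unit_ball X v.
  move=> h; apply: le_trans h _.
  have h1 : C * (C * eta) <= 2^-1.
    rewrite mulrA mulrC -ler_pdivlMr ?mulr_gt0//.
    by rewrite -invfM mulrA ge_min lexx orbT.
  have h2 : C * (C * (C * delta)) = 2^-1.
    by rewrite /delta; field; rewrite gt_eqF.
  by rewrite !mulrDr h2; lra.
exists delta, eta, B; split=> //.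
  by move=> v w /inb ? /inb ?; exact: BP.
apply: le_lt_trans qrho.
have le1 : (omega (unit_ball X) phi (C * eta) <= omega (unit_ball X) phi s1)%E.
  by apply: le_omega; rewrite mulrC -ler_pdivlMr// ge_min lexx.
apply: (@le_trans _ _ (Ku%:E * (q / Ku)%:E)%E).
  apply: lee_wpmul2l; first by rewrite lee_fin ltW.
  by apply: le_trans le1 _; exact: ltW.
by rewrite -EFinM mulrC divfK// gt_eqF.
Qed.

Theorem theorem16 (R : realType) (X : completeNormedModType R) :
  (exists Y : metricType R, upper_stable Y /\
     exists phi : X -> Y, coarse_embedding (@setT X) phi) \/
  (exists Y : metricType R, upper_stable Y /\
     exists phi : X -> Y, uniform_embedding (unit_ball X) phi) ->
  forall x : nat -> X, basic_sequence x -> spreading x -> unconditional x.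
Proof.
move=> [[Y [us [phi ce]]]|[Y [us [phi ue]]]] x bs sp.
- apply: (@unconditional_of_gap _ _ _ setT phi _ us bs sp) => Ku C L.
  exact: coarse_gap ce.
- apply: (@unconditional_of_gap _ _ _ (unit_ball X) phi _ us bs sp) => Ku C L.
  exact: uniform_gap ue.
Qed.
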